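(* For all positive integers $n$ and $j$, \[ \sum_{k=0}^{\lfloor n/2\rfloor}\binom{n}{2k}(5F_j^2)^k\left(\frac{F_{j(n-2k+1)}}{n-2k+1}B_{2k}-\frac{F_jL_j^{n-2k}}{2^n}\right)=0, \] \[ \sum_{k=0}^{\lfloor n/2\rfloor}\binom{n}{2k}\frac{(5F_j^2)^k}{2k+1}\left(\frac{4^{k+1}-1}{k+1}L_{j(n-2k)}B_{2k+2}-\frac{L_j^{n-2k}}{2^n}\right)=0. \]
   Context: $F_n$ and $L_n$ denote the Fibonacci and Lucas numbers: $F_0=0,F_1=1$, $L_0=2,L_1=1$, and $u_n=u_{n-1}+u_{n-2}$. The Bernoulli numbers $B_n$ are defined by $\sum_{n\ge0}B_n\frac{z^n}{n!}=\frac{z}{e^z-1}$. *)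

(* Defs.v *)
From HB Require Import structures.
From mathcomp Require Import all_boot all_order all_algebra.
Set Implicit Arguments.
Unset Strict Implicit.
Unset Printing Implicit Defensive.
Import Order.TTheory GRing.Theory Num.Theory.
Local Open Scope ring_scope.

Fixpoint fib (n : nat) : nat :=
  match n with
  | 0 => 0
  | m.+1 => match m with 0 => 1 | p.+1 => fib m + fib p end
  end%N.

Fixpoint lucas (n : nat) : nat :=
  match n with
  | 0 => 2
  | m.+1 => match m with 0 => 1 | p.+1 => lucas m + lucas p end
  end%N.

(* The formal power series \sum_n (a n) z^n is represented by its coefficient
   sequence a. *)
Definition fps := nat -> rat.

Definition fps_mul (a b : fps) : fps :=
  fun n => \sum_(i < n.+1) a i * b (n - i)%N.

Definition fps_one : fps := fun n => (n == 0%N)%:R.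

Definition fps_z : fps := fun n => (n == 1%N)%:R.

Definition egf (u : nat -> rat) : fps := fun n => u n / n`!%:R.

Definition fps_expm1 : fps := fun n => egf (fun=> 1) n - fps_one n.

(* The first n coefficients of 1 / a, from (1 / a) * a = 1. *)
Fixpoint fps_inv_seq (a : fps) (n : nat) : seq rat :=
  if n is m.+1 then
    let s := fps_inv_seq a m in
    rcons s ((fps_one m - \sum_(i < m) s`_i * a (m - i)%N) / a 0%N)
  else [::].

(* Multiplicative inverse; meaningful when a 0 != 0. *)
Definition fps_inv (a : fps) : fps := fun n => (fps_inv_seq a n.+1)`_n.

(* z / (e^z - 1) is the inverse of (e^z - 1) / z, whose constant term is 1. *)
Definition bernoulli (n : nat) : rat :=
  n`!%:R * fps_inv (fun m => fps_expm1 m.+1) n.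

Lemma size_fps_inv_seq a n : size (fps_inv_seq a n) = n.
Proof. by elim: n => //= n IHn; rewrite size_rcons IHn. Qed.

Lemma nth_fps_inv_seq a n i : (i < n)%N -> (fps_inv_seq a n)`_i = fps_inv a i.
Proof.
elim: n => // n IHn; rewrite ltnS leq_eqVlt => /orP[/eqP -> //|lt_in].
by rewrite /= nth_rcons size_fps_inv_seq lt_in IHn.
Qed.

Lemma fps_mul_inv a : a 0%N != 0 -> fps_mul (fps_inv a) a =1 fps_one.
Proof.
move=> a0 n; rewrite /fps_mul big_ord_recr /= subnn.
rewrite {2}/fps_inv /= nth_rcons size_fps_inv_seq ltnn eqxx divfK //.
under [X in _ + (_ - X)]eq_bigr => i _ do rewrite nth_fps_inv_seq //.
by rewrite addrC subrK.
Qed.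

Lemma egf_bernoulli n :
  egf bernoulli n = fps_inv (fun m => fps_expm1 m.+1) n.
Proof.
by rewrite /egf /bernoulli mulrAC divff ?mul1r // pnatr_eq0 -lt0n fact_gt0.
Qed.

Lemma bernoulli_gf : fps_mul (egf bernoulli) fps_expm1 =1 fps_z.
Proof.
case=> [|n].
  by rewrite /fps_mul big_ord1 /fps_expm1 /egf /fps_one /= subrr mulr0.
rewrite /fps_mul big_ord_recr /= subnn.
rewrite [X in _ + _ * X](_ : _ = 0) ?mulr0 ?addr0; last first.
  by rewrite /fps_expm1 /egf /fps_one /= subrr.
have a0 : fps_expm1 1%N != 0 by rewrite /fps_expm1 /egf /fps_one.
rewrite /fps_z eqSS -/(fps_one n) -(@fps_mul_inv (fun m => fps_expm1 m.+1) a0) /fps_mul.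
by apply: eq_bigr => i _; rewrite egf_bernoulli subSn // -ltnS.
Qed.

Lemma bernoulli_unique (B : nat -> rat) :
  fps_mul (egf B) fps_expm1 =1 fps_z -> B =1 bernoulli.
Proof.
move=> BP n; have [m] := ubnP n; elim: m n => // m IHm n lt_nm.
have e1 : fps_expm1 1%N = 1 by rewrite /fps_expm1 /egf /fps_one /= subr0 divr1.
have e0 : fps_expm1 0%N = 0 by rewrite /fps_expm1 /egf /fps_one /= subrr.
have := BP n.+1; rewrite -(bernoulli_gf n.+1) /fps_mul.
rewrite 2![\sum_(i < n.+2) _]big_ord_recr /= subnn e0 !mulr0 !addr0.
rewrite 2![\sum_(i < n.+1) _]big_ord_recr /= subSnn e1 !mulr1.
under eq_bigr => i _ do
  rewrite /egf IHm ?(leq_trans (ltn_ord i)) // -/(egf bernoulli i).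
move/addrI; rewrite /egf; apply: mulIf.
by rewrite invr_eq0 pnatr_eq0 -lt0n fact_gt0.
Qed.

(* Main.v *)
Require Import Defs.
From HB Require Import structures.
From mathcomp Require Import all_boot all_order all_algebra.
From mathcomp Require Import all_field.
From mathcomp Require Import ring zify.
Set Implicit Arguments.
Unset Strict Implicit.
Unset Printing Implicit Defensive.
Import Order.TTheory GRing.Theory Num.Theory.
Local Open Scope ring_scope.

(* With a, b the j-th powers of the roots of x^2 = x + 1 and d = a - b, one has
   d^2 = 5 F_j^2 and a + b = L_j, so Binet's formulas turn both identities into
   statements on A_c(x, m) = \sum_i C(m,i) c^i B_i x^(m-i), the homogenized
   Bernoulli polynomial.  Up to the term i = 1, which is corrected by hand, only
   even i contribute.  The first sum is then a difference A_d(b+d) - A_d(b),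
   given by B_m(x+1) - B_m(x) = m x^(m-1); the second is
   (A_2d - A_d)(b+d) + (A_2d - A_d)(b), given in addition by the duplication
   formula B_m(x) + B_m(x+1/2) = 2^(1-m) B_m(2x).  The reflection and
   duplication formulas follow from the fact that B is the only sequence with
   \sum_(i<=m) C(m,i) B_i = B_m + [m = 1]. *)

(** * Appell polynomials of a sequence: scaling and addition *)

Lemma bin_mul_bin m N i : (i <= N)%N -> (N <= m)%N ->
  ('C(m, i) * 'C(m - i, N - i) = 'C(m, N) * 'C(N, i))%N.
Proof.
move=> leiN leNm; pose c := (i`! * (N - i)`! * (m - N)`!)%N.
have c_gt0 : (0 < c)%N by rewrite !muln_gt0 !fact_gt0.
apply/eqP; rewrite -(eqn_pmul2r c_gt0) /c; apply/eqP.
have H1 := bin_fact (leq_trans leiN leNm); have H2 := bin_fact leNm.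
have H3 := bin_fact leiN.
have H4 := bin_fact (leq_sub2r i leNm).
have E : (m - i - (N - i) = m - N)%N by lia.
rewrite E in H4.
transitivity m`!; first by rewrite -H1 -H4; ring.
by rewrite -H2 -H3; ring.
Qed.

(** Umbrally [(u + x)^m]. Putting [m] last makes [appell u x] a sequence again, so that shifts can
    be iterated. *)
Definition appell (R : comNzRingType) (u : nat -> R) (x : R) (m : nat) : R :=
  \sum_(i < m.+1) 'C(m, i)%:R * u i * x ^+ (m - i).

Lemma appell_ext (R : comNzRingType) (u v : nat -> R) x m :
  u =1 v -> appell u x m = appell v x m.
Proof. by move=> uv; apply: eq_bigr => i _; rewrite uv. Qed.

Lemma appell0 (R : comNzRingType) (u : nat -> R) m : appell u 0 m = u m.
Proof.
rewrite /appell big_ord_recr /= subnn expr0 mulr1 binn mul1r big1 ?add0r // => i _.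
by rewrite expr0n subn_eq0 leqNgt ltn_ord mulr0.
Qed.

Lemma appell_add (R : comNzRingType) (u v : nat -> R) x m :
  appell (fun i => u i + v i) x m = appell u x m + appell v x m.
Proof. by rewrite -big_split; apply: eq_bigr => i _ /=; ring. Qed.

Lemma appell_mull (R : comNzRingType) c (u : nat -> R) x m :
  appell (fun i => c * u i) x m = c * appell u x m.
Proof. by rewrite /appell mulr_sumr; apply: eq_bigr => i _ /=; ring. Qed.

Lemma appell_scale (R : comNzRingType) c (u : nat -> R) x m :
  appell (fun i => c ^+ i * u i) (c * x) m = c ^+ m * appell u x m.
Proof.
rewrite /appell mulr_sumr; apply: eq_bigr => i _.
have -> : c ^+ m = c ^+ i * c ^+ (m - i) by rewrite -exprD subnKC // -ltnS.
by rewrite exprMn; ring.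
Qed.

Lemma appell_delta1 (R : comNzRingType) (c x : R) m :
  appell (fun i => c * (i == 1%N)%:R) x m = m%:R * c * x ^+ m.-1.
Proof.
case: m => [|m]; first by rewrite /appell big_ord1 /=; ring.
rewrite /appell big_ord_recl big_ord_recl big1 => [|i _] /=.
  by rewrite bin1 subn1 /=; ring.
by rewrite /bump /=; ring.
Qed.

(** Umbrally both sides are [(u + x + y)^m]: expand [(x + y) ^+ (m - i)], regroup by [N = i + l] and
    apply [bin_mul_bin]. *)
Lemma appellD (R : comNzRingType) (u : nat -> R) x y m :
  appell u (x + y) m = appell (appell u y) x m.
Proof.
pose F i l := 'C(m, i)%:R * 'C(m - i, l)%:R * u i * x ^+ (m - i - l) * y ^+ l.
transitivity (\sum_(i < m.+1) \sum_(N < m.+1 | (i <= N)%N) F i (N - i)%N).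
  apply: eq_bigr => i _.
  rewrite -(big_mkord (fun N => i <= N)%N (fun N => F i (N - i)%N)).
  rewrite (big_cat_nat (n := i)) //=; last by rewrite ltnW.
  rewrite big_nat_cond big1 ?add0r; last by move=> N; lia.
  rewrite big_nat_cond (eq_bigl (fun N => i <= N < m.+1)%N); last by move=> N; lia.
  rewrite -big_nat -[X in index_iota X]add0n big_addn subSn; last by rewrite -ltnS.
  rewrite exprDn mulr_sumr big_mkord; apply: eq_bigr => l _.
  by rewrite addnK /F; ring.
rewrite (exchange_big_dep xpredT) //=; apply: eq_bigr => N _.
rewrite /appell mulr_sumr mulr_suml.
have leNm : (N <= m)%N by rewrite -ltnS.
rewrite -(big_mkord (fun i => i <= N)%N (fun i => F i (N - i)%N)).
rewrite (big_cat_nat (n := N.+1)) //=.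
rewrite [X in _ + X]big_nat_cond [X in _ + X]big1 ?addr0; last by move=> i; lia.
rewrite big_nat_cond (eq_bigl (fun i => 0 <= i < N.+1)%N); last by move=> i; lia.
rewrite -big_nat big_mkord; apply: eq_bigr => i _.
have leiN : (i <= N)%N by rewrite -ltnS.
have -> : F i (N - i)%N = ('C(m, i) * 'C(m - i, N - i))%:R * u i * x ^+ (m - N) * y ^+ (N - i).
  by rewrite /F natrM; congr (_ * _ ^+ _ * _); lia.
by rewrite bin_mul_bin // natrM; ring.
Qed.

(** * Bernoulli numbers: recurrence, reflection, duplication *)

Lemma fact_neq0 (F : numFieldType) n : n`!%:R != 0 :> F.
Proof. by rewrite pnatr_eq0 -lt0n fact_gt0. Qed.

(** A product of exponential generating functions is a binomial convolution; the [-1] in [e^z - 1]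
    only removes the term [i = m]. *)
Lemma fps_mul_egf_expm1 (B : nat -> rat) m :
  m`!%:R * fps_mul (egf B) fps_expm1 m = appell B 1 m - B m.
Proof.
rewrite /fps_mul /fps_expm1.
under eq_bigr => i _ do rewrite mulrBr.
rewrite sumrB mulrBr; congr (_ - _).
  rewrite mulr_sumr; apply: eq_bigr => i _; rewrite expr1n /egf.
  have lim : (i <= m)%N by rewrite -ltnS.
  rewrite -(bin_fact lim) !natrM.
  by field; rewrite !fact_neq0.
rewrite big_ord_recr /= subnn big1 => [|i _].
  by rewrite /egf /fps_one /=; field; rewrite fact_neq0.
by rewrite /fps_one subn_eq0 leqNgt ltn_ord mulr0.
Qed.

Lemma appell_bernoulli1 m :
  appell bernoulli 1 m = bernoulli m + (m == 1%N)%:R.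
Proof.
apply/eqP; rewrite addrC -subr_eq -fps_mul_egf_expm1 bernoulli_gf /fps_z.
by case: m => [|[|m]] /=; rewrite ?mulr0 ?mulr1.
Qed.

Lemma appell1_bernoulli (B : nat -> rat) :
  (forall m, appell B 1 m = B m + (m == 1%N)%:R) -> B =1 bernoulli.
Proof.
move=> BP; apply: bernoulli_unique => m.
apply: (mulfI (fact_neq0 _ m)); rewrite fps_mul_egf_expm1 BP addrC addKr /fps_z.
by case: m => [|[|m]] /=; rewrite ?mulr0 ?mulr1.
Qed.

(** The left side is [(-1)^m B_m(1)]. It satisfies the Bernoulli recurrence: since
    [1 = (-1) * (-1)], shifting it by 1 gives [(-1)^m B_m(-1 + 1)]. *)
Lemma bernoulli_reflect m :
  (-1) ^+ m * (bernoulli m + (m == 1%N)%:R) = bernoulli m.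
Proof.
move: m; apply: appell1_bernoulli => m.
under appell_ext => i do rewrite -appell_bernoulli1.
rewrite [X in appell _ X](_ : 1 = (-1) * (-1)); last by ring.
rewrite appell_scale.
rewrite -appellD addNr appell0 mulrDr.
by case: m => [|[|m]] /=; ring.
Qed.

Lemma bernoulli_odd m : odd m -> m != 1%N -> bernoulli m = 0.
Proof.
move=> om m1; have := bernoulli_reflect m.
rewrite (negbTE m1) addr0 -signr_odd om mulN1r => /eqP.
by rewrite eq_sym -addr_eq0 -mulr2n mulrn_eq0 => /eqP.
Qed.

Lemma bernoulli1 : bernoulli 1 = - 2^-1.
Proof.
have := bernoulli_reflect 1; rewrite eqxx expr1 => H.
have H2 : 2 * bernoulli 1 = -1 by rewrite mulr_natl mulr2n -{1}H /=; ring.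
by apply: (mulfI (_ : 2 != 0)) => //; rewrite H2.
Qed.

(** Duplication at [x = 0], the left side being [2^m B_m(1/2)]. The average of [u] and its shift by
    1 satisfies the Bernoulli recurrence: one more shift trades [u] for its shift by 2, which is
    [2^k B_k(1)]. *)
Lemma appell_bernoulli_dup m :
  appell (fun i => 2 ^+ i * bernoulli i) 1 m = 2 * bernoulli m - 2 ^+ m * bernoulli m.
Proof.
pose u i : rat := 2 ^+ i * bernoulli i.
have : (fun k => 2^-1 * (u k + appell u 1 k)) =1 bernoulli.
  apply: appell1_bernoulli => k.
  rewrite appell_mull appell_add -appellD.
  rewrite [X in _ * (_ + appell u X k)](_ : _ = 2 * 1); last by ring.
  rewrite appell_scale appell_bernoulli1 mulrDr.
  rewrite (_ : u k = 2 ^+ k * bernoulli k) //; by case: k => [|[|k]] /=; rewrite ?expr1; field.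
by move=> /(_ m) E; rewrite -[X in 2 * X]E -/u (_ : u m = 2 ^+ m * bernoulli m) //; field.
Qed.

(* As B_1 = -1/2, the correction at i = 1 leaves the even part of c^i B_i. *)
Definition even_bernoulli (F : numFieldType) (c : F) (i : nat) : F :=
  c ^+ i * ratr (bernoulli i) + c / 2 * (i == 1%N)%:R.

(** * Difference and duplication formulas for the even part *)

Section EvenBernoulli.
Variable F : numFieldType.
Implicit Types c d x : F.

Lemma even_bernoulli_odd c i : odd i -> even_bernoulli c i = 0.
Proof.
rewrite /even_bernoulli; case: eqP => [->|/eqP i1] oi.
  by rewrite bernoulli1 expr1 rmorphN fmorphV rmorph_nat mulr1; field.
by rewrite bernoulli_odd // rmorph0 !mulr0 addr0.
Qed.

Lemma even_bernoulli_even c k : even_bernoulli c (2 * k) = c ^+ (2 * k) * ratr (bernoulli (2 * k)).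
Proof.
by rewrite /even_bernoulli (_ : (2 * k == 1)%N = false) ?mulr0 ?addr0 //; lia.
Qed.

Lemma ratr_appell1 (u : nat -> rat) m :
  appell (fun i => ratr (u i)) 1 m = ratr (appell u 1 m) :> F.
Proof.
rewrite rmorph_sum; apply: eq_bigr => i _.
by rewrite !expr1n !mulr1 rmorphM rmorph_nat.
Qed.

Lemma appell_even_bernoulli c x m :
  appell (even_bernoulli c) x m =
    appell (fun i => c ^+ i * ratr (bernoulli i)) x m + m%:R * (c / 2) * x ^+ m.-1.
Proof. by rewrite appell_add appell_delta1. Qed.

(** The homogenized difference formula adds [m d x^(m-1)]; the correction at [i = 1] adds half the
    difference of the two powers, which makes the last term symmetric. *)
Lemma appell_even_bernoulliD d x m :
  appell (even_bernoulli d) (x + d) m =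
    appell (even_bernoulli d) x m + m%:R * d / 2 * (x ^+ m.-1 + (x + d) ^+ m.-1).
Proof.
rewrite !appell_even_bernoulli appellD.
under appell_ext => i.
  (* Reading the shift [d] as [d * 1] reduces it to the shift by 1 of the Bernoulli numbers. *)
  rewrite -[X in appell _ X]mulr1 appell_scale ratr_appell1.
  rewrite appell_bernoulli1 rmorphD rmorph_nat mulrDr.
  rewrite [X in _ + X](_ : _ = d * (i == 1%N)%:R); last first.
    by case: i => [|[|i]]; rewrite ?mulr0.
  over.
by rewrite appell_add appell_delta1; field.
Qed.

(** Without corrections the last term is absent; it is what remains of the corrections, [m d] times
    both powers on the left against [m d x^(m-1)] on the right. *)
Lemma appell_even_bernoulli_dup d x m :
  appell (even_bernoulli (2 * d)) (x + d) m + appell (even_bernoulli (2 * d)) x m =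
    2 * appell (even_bernoulli d) x m + m%:R * d * (x + d) ^+ m.-1.
Proof.
rewrite !appell_even_bernoulli appellD.
have E i : appell (fun i => (2 * d) ^+ i * ratr (bernoulli i)) d i =
   2 * (d ^+ i * ratr (bernoulli i)) + (-1) * ((2 * d) ^+ i * ratr (bernoulli i)).
  rewrite (@appell_ext _ _ (fun i => d ^+ i * (2 ^+ i * ratr (bernoulli i)))); last first.
    by move=> k; rewrite exprMn; ring.
  rewrite -[X in appell _ X]mulr1 appell_scale.
  rewrite (@appell_ext _ _ (fun i => ratr (2 ^+ i * bernoulli i))); last first.
    by move=> k; rewrite [RHS]rmorphM rmorphXn rmorph_nat.
  rewrite ratr_appell1 appell_bernoulli_dup rmorphB.
  rewrite [X in _ * (X - _)]rmorphM [X in _ * (_ - X)]rmorphM.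
  rewrite rmorphXn rmorph_nat exprMn.
  by ring.
by rewrite (appell_ext _ _ E) appell_add !appell_mull; field.
Qed.

End EvenBernoulli.

(** * Closed forms of the four sums over even indices *)

Lemma sum_even (V : nmodType) (f : nat -> V) m :
  (forall i, odd i -> f i = 0) ->
  \sum_(0 <= k < m./2.+1) f (2 * k)%N = \sum_(i < m.+1) f i.
Proof.
move=> f_odd; elim: m => [|m IHm]; first by rewrite big_nat1 big_ord1.
rewrite big_ord_recr /= -IHm; case: (boolP (odd m)) => om.
  by rewrite uphalf_half om big_nat_recr //=; congr (_ + f _); lia.
by rewrite uphalf_half (negbTE om) f_odd ?addr0.
Qed.

Section Sums.
Variable F : numFieldType.
Implicit Types a b c d s : F.

Lemma sum_bernoulli_sub a b n :
  \sum_(0 <= k < n./2.+1) 'C(n, 2 * k)%:R * (a - b) ^+ (2 * k) *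
    ((a ^+ (n - 2 * k + 1) - b ^+ (n - 2 * k + 1)) / (n - 2 * k + 1)%:R
      * ratr (bernoulli (2 * k)))
  = (a - b) * (a ^+ n + b ^+ n) / 2.
Proof.
pose d := a - b; rewrite -/d.
pose g i := 'C(n.+1, i)%:R * even_bernoulli d i * a ^+ (n.+1 - i)
          - 'C(n.+1, i)%:R * even_bernoulli d i * b ^+ (n.+1 - i).
transitivity (n.+1%:R^-1 * \sum_(0 <= k < n./2.+1) g (2 * k)%N).
  rewrite mulr_sumr; apply: eq_big_nat => k lek; rewrite /g even_bernoulli_even.
  have -> : (n - 2 * k + 1 = n.+1 - 2 * k)%N by lia.
  (* Absorption: [C(n,2k) / (n+1-2k) = C(n+1,2k) / (n+1)], which raises the degree to [n + 1]. *)
  have := mul_bin_down n.+1 (2 * k); rewrite /= => /(congr1 (fun x => x%:R : F)).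
  rewrite !natrM; have: (n.+1 - 2 * k)%:R != 0 :> F by rewrite pnatr_eq0; lia.
  have: n.+1%:R != 0 :> F by rewrite pnatr_eq0.
  set p := n.+1%:R; set q := (n.+1 - 2 * k)%:R; clearbody p q => p0 q0 E.
  rewrite (_ : 'C(n, 2 * k)%:R = q * 'C(n.+1, 2 * k)%:R / p).
    by field; rewrite p0 q0.
  by rewrite -E; field.
rewrite sum_even => [|i oi]; last by rewrite /g even_bernoulli_odd //; ring.
(* The missing top term is zero because [a^0 - b^0 = 0]. *)
have -> : \sum_(i < n.+1) g i = \sum_(i < n.+2) g i.
  by rewrite [RHS]big_ord_recr /= {3}/g subnn !expr0 subrr addr0.
have := appell_even_bernoulliD d b n.+1; rewrite addrC subrK /= => E.
rewrite sumrB -!/(appell _ _ _) E; field.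
by rewrite nat1r pnatr_eq0.
Qed.

Lemma sum_bernoulli_add a b n : a != b ->
  \sum_(0 <= k < n./2.+1) 'C(n, 2 * k)%:R * ((a - b) ^+ (2 * k) / (2 * k + 1)%:R) *
    ((4 ^+ (k + 1) - 1) / (k + 1)%:R * (a ^+ (n - 2 * k) + b ^+ (n - 2 * k))
      * ratr (bernoulli (2 * k + 2)))
  = (a ^+ n.+1 - b ^+ n.+1) / (n.+1%:R * (a - b)).
Proof.
rewrite -subr_eq0; pose d := a - b; rewrite -/d => d0.
pose f c x i := 'C(n.+2, i)%:R * even_bernoulli c i * x ^+ (n.+2 - i).
(* The factor [4^(k+1) - 1] comes from [(2d)^(2k+2) - d^(2k+2)]. *)
pose g i := f (2 * d) a i + f (2 * d) b i - (f d a i + f d b i).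
transitivity (2 / (n.+1%:R * n.+2%:R * d ^+ 2)
               * \sum_(0 <= k < n.+2./2.+1) g (2 * k)%N).
  (* The index becomes [2k + 2]; the extra term at 0 vanishes since [(2d)^0 = d^0]. *)
  rewrite [in RHS]big_nat_recl //.
  rewrite (_ : g (2 * 0)%N = 0) ?add0r; last first.
    by rewrite /g /f /even_bernoulli !expr0 /=; ring.
  rewrite mulr_sumr; apply: eq_big_nat => k lek.
  rewrite /g /f !even_bernoulli_even.
  have -> : (n.+2 - 2 * k.+1 = n - 2 * k)%N by lia.
  have -> : (2 * k + 2 = 2 * k.+1)%N by lia.
  (* Two absorptions raise [C(n,2k)] to [C(n+2,2k+2)]. *)
  have E : (n.+2 * (n.+1 * 'C(n, 2 * k)) =
            2 * ((k + 1) * ((2 * k + 1) * 'C(n.+2, 2 * k.+1))))%N.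
    rewrite mul_bin_diag mulnCA mul_bin_diag (_ : (2 * k).+2 = 2 * k.+1)%N; lia.
  move/(congr1 (fun x => x%:R : F)): E; rewrite 5!natrM.
  have: n.+2%:R != 0 :> F by rewrite pnatr_eq0.
  have: n.+1%:R != 0 :> F by rewrite pnatr_eq0.
  have: (2 * k + 1)%:R != 0 :> F by rewrite pnatr_eq0; lia.
  have: (k + 1)%:R != 0 :> F by rewrite pnatr_eq0; lia.
  set p := n.+2%:R; set q := n.+1%:R; set u := (2 * k + 1)%:R; set v := (k + 1)%:R.
  clearbody p q u v.
  move=> v0 u0 q0 p0 E.
  rewrite (_ : 'C(n, 2 * k)%:R = 2 * (v * (u * 'C(n.+2, 2 * k.+1)%:R)) / (p * q)); last first.
    by rewrite -E; field; rewrite q0 p0.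
  rewrite exprMn (_ : d ^+ (2 * k.+1) = d ^+ 2 * d ^+ (2 * k)); last first.
    by rewrite -exprD; congr (_ ^+ _); lia.
  rewrite (exprM 2) (_ : 2 ^+ 2 = 4 :> F); last by ring.
  by rewrite addn1; field; rewrite p0 q0 u0 v0 d0.
rewrite sum_even => [|i oi]; last by rewrite /g /f !even_bernoulli_odd //; ring.
have := appell_even_bernoulli_dup d b n.+2.
have := appell_even_bernoulliD d b n.+2.
rewrite [b + d]addrC subrK /= => E1 E2.
rewrite sumrB !big_split /= -/(appell (even_bernoulli (2 * d)) a n.+2).
rewrite -/(appell (even_bernoulli (2 * d)) b n.+2).
rewrite -/(appell (even_bernoulli d) a n.+2) -/(appell (even_bernoulli d) b n.+2).
(* Both combinations contain [2 A_d(b)], which cancels and leaves only powers of [a] and [b]. *)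
rewrite E2 E1 !exprS.
have: n.+2%:R != 0 :> F by rewrite pnatr_eq0.
have: n.+1%:R != 0 :> F by rewrite pnatr_eq0.
set p := n.+2%:R; set q := n.+1%:R; clearbody p q => q0 p0.
by rewrite -[a](subrK b) -/d; field; rewrite d0 p0 q0.
Qed.

(** Averaging the expansions for [d] and [-d] kills odd indices. It is used with [s = a + b],
    [d = a - b], where [s + d = 2a] and [s - d = 2b]. *)
Lemma sum_even_binomial s d n :
  \sum_(0 <= k < n./2.+1) 'C(n, 2 * k)%:R * d ^+ (2 * k) * s ^+ (n - 2 * k)
  = ((s + d) ^+ n + (s - d) ^+ n) / 2.
Proof.
pose g i := 2^-1 * ('C(n, i)%:R * (d ^+ i + (- d) ^+ i) * s ^+ (n - i)).
transitivity (\sum_(0 <= k < n./2.+1) g (2 * k)%N).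
  by apply: eq_bigr => k _; rewrite /g [(- d) ^+ _]exprM sqrrN -exprM; field.
rewrite sum_even => [|i oi]; last first.
  by rewrite /g exprNn -signr_odd oi expr1; ring.
rewrite -mulr_sumr !exprDn -big_split mulrC; congr (_ / _).
by apply: eq_bigr => i _ /=; ring.
Qed.

(** As [C(n,2k) / (2k+1) = C(n+1,2k+1) / (n+1)], this is the odd part of the expansion in degree
    [n + 1]. *)
Lemma sum_even_binomial_div s d n : d != 0 ->
  \sum_(0 <= k < n./2.+1) 'C(n, 2 * k)%:R * (d ^+ (2 * k) / (2 * k + 1)%:R) * s ^+ (n - 2 * k)
  = ((s + d) ^+ n.+1 - (s - d) ^+ n.+1) / (2 * n.+1%:R * d).
Proof.
move=> d0.
pose h i := 'C(n.+1, i)%:R * (d ^+ i - (- d) ^+ i) * s ^+ (n.+1 - i).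
transitivity ((2 * n.+1%:R * d)^-1 * \sum_(0 <= k < n./2.+1) h (2 * k).+1).
  rewrite mulr_sumr; apply: eq_bigr => k _; rewrite /h subSS.
  have := mul_bin_diag n.+1 (2 * k); rewrite /= => /(congr1 (fun x => x%:R : F)).
  rewrite !natrM addn1.
  have: n.+1%:R != 0 :> F by rewrite pnatr_eq0.
  have: (2 * k).+1%:R != 0 :> F by rewrite pnatr_eq0.
  set p := n.+1%:R; set q := (2 * k).+1%:R; clearbody p q => q0 p0 E.
  rewrite (_ : 'C(n, 2 * k)%:R = q * 'C(n.+1, (2 * k).+1)%:R / p); last first.
    by rewrite -E; field.
  rewrite (exprS (- d)) [(- d) ^+ _]exprM sqrrN -exprM exprS.
  by field; rewrite p0 q0 d0.
rewrite (@sum_even _ (fun i => h i.+1)) => [|i oi]; last first.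
  by rewrite /h exprNn -signr_odd /= oi; ring.
have -> : \sum_(i < n.+1) h i.+1 = \sum_(i < n.+2) h i.
  by rewrite [RHS]big_ord_recl /= {2}/h !expr0; ring.
rewrite !exprDn -sumrB mulrC; congr (_ / _).
by apply: eq_bigr => i _ /=; rewrite /h; ring.
Qed.

End Sums.

(** * Binet's formulas *)

Section Binet.
Variables (R : comNzRingType) (x y : R).
Hypotheses (x2 : x ^+ 2 = x + 1) (y2 : y ^+ 2 = y + 1) (xDy : x + y = 1).

Lemma fib_binet n : (fib n)%:R * (x - y) = x ^+ n - y ^+ n.
Proof.
have [m] := ubnP n; elim: m n => // m IHm [|[|n]] ltnm; first by rewrite /=; ring.
  by rewrite /= !expr1 mul1r.
rewrite [fib n.+2](_ : _ = fib n.+1 + fib n)%N // natrD mulrDl.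
rewrite !IHm //; last exact: ltnW.
by rewrite -[n.+2]add2n -[n.+1]add1n !exprD x2 y2; ring.
Qed.

Lemma lucas_binet n : (lucas n)%:R = x ^+ n + y ^+ n.
Proof.
have [m] := ubnP n; elim: m n => // m IHm [|[|n]] ltnm; first by rewrite /=; ring.
  by rewrite /= !expr1 xDy.
rewrite [lucas n.+2](_ : _ = lucas n.+1 + lucas n)%N // natrD.
rewrite !IHm //; last exact: ltnW.
by rewrite -[n.+2]add2n -[n.+1]add1n !exprD x2 y2; ring.
Qed.

End Binet.

Lemma fib_gt0 n : (0 < n)%N -> (0 < fib n)%N.
Proof.
case: n => // n _; elim: n => // n IHn.
by rewrite [fib n.+2](_ : _ = fib n.+1 + fib n)%N // addn_gt0 IHn.
Qed.

Theorem theorem5 (n j : nat) (hn : (0 < n)%N) (hj : (0 < j)%N) :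
  \sum_(0 <= k < n./2.+1)
     'C(n, 2 * k)%:R * (5 * (fib j)%:R ^+ 2) ^+ k
     * ((fib (j * (n - 2 * k + 1)))%:R / (n - 2 * k + 1)%:R * bernoulli (2 * k)
        - (fib j)%:R * (lucas j)%:R ^+ (n - 2 * k) / 2 ^+ n) = 0 :> rat
  /\
  \sum_(0 <= k < n./2.+1)
     'C(n, 2 * k)%:R * ((5 * (fib j)%:R ^+ 2) ^+ k / (2 * k + 1)%:R)
     * ((4 ^+ (k + 1) - 1) / (k + 1)%:R * (lucas (j * (n - 2 * k)))%:R
          * bernoulli (2 * k + 2)
        - (lucas j)%:R ^+ (n - 2 * k) / 2 ^+ n) = 0 :> rat.
Proof.
(* The roots need the square root of 5, so the computation takes place in [algC]. *)
pose r : algC := sqrtC 5.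
have r2 : r ^+ 2 = 5 by rewrite sqrtCK.
have r0 : r != 0 by rewrite sqrtC_eq0 pnatr_eq0.
pose x : algC := (1 + r) / 2; pose y : algC := (1 - r) / 2.
have x2 : x ^+ 2 = x + 1.
  have -> : x ^+ 2 = (1 + 2 * r + r ^+ 2) / 4 by rewrite /x; field.
  by rewrite r2 /x; field.
have y2 : y ^+ 2 = y + 1.
  have -> : y ^+ 2 = (1 - 2 * r + r ^+ 2) / 4 by rewrite /y; field.
  by rewrite r2 /y; field.
have xDy : x + y = 1 by rewrite /x /y; field.
have xBy : x - y = r by rewrite /x /y; field.
clearbody r x y.
have fibE m : (fib m)%:R = (x ^+ m - y ^+ m) / r.
  by rewrite -(fib_binet x2 y2) xBy mulfK.
have lucasE m : (lucas m)%:R = x ^+ m + y ^+ m := lucas_binet x2 y2 xDy m.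
pose a := x ^+ j; pose b := y ^+ j.
have abE : a - b = r * (fib j)%:R by rewrite fibE mulrC divfK.
have ab0 : a - b != 0.
  by rewrite abE mulf_neq0 // pnatr_eq0 -lt0n fib_gt0.
have dE k : (5 * (fib j)%:R ^+ 2) ^+ k = (a - b) ^+ (2 * k).
  by rewrite abE exprM [(r * _) ^+ 2]exprMn r2.
have sE : (lucas j)%:R = a + b by rewrite lucasE.
have aE : a + b + (a - b) = 2 * a by ring.
have bE : a + b - (a - b) = 2 * b by ring.
have fibjE m : (fib (j * m))%:R = (a ^+ m - b ^+ m) / r by rewrite fibE !exprM.
have lucasjE m : (lucas (j * m))%:R = a ^+ m + b ^+ m by rewrite lucasE !exprM.
clearbody a b.
have two0 m : 2 ^+ m != 0 :> algC by rewrite expf_neq0 // pnatr_eq0.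
(* The embedding of [rat] is injective, so each sum may be shown to vanish in [algC]. *)
split; apply: (fmorph_inj (@ratr algC)); rewrite rmorph0 rmorph_sum /=.
  (* Both halves equal [F_j (a^n + b^n) / 2]. *)
  transitivity (r^-1 * ((a - b) * (a ^+ n + b ^+ n) / 2)
     - (fib j)%:R / 2 ^+ n * (((a + b + (a - b)) ^+ n + (a + b - (a - b)) ^+ n) / 2)).
    rewrite -sum_bernoulli_sub -sum_even_binomial !mulr_sumr -sumrB.
    apply: eq_bigr => k _; move: (bernoulli _) => B.
    rewrite !(rmorphM, rmorphB, rmorphXn, fmorphV, rmorph_nat) /= dE sE.
    by rewrite fibjE; ring.
  by rewrite aE bE !exprMn abE; field; rewrite r0 two0.
(* Here both halves equal [(a^(n+1) - b^(n+1)) / ((n+1)(a - b))]. *)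
transitivity ((a ^+ n.+1 - b ^+ n.+1) / (n.+1%:R * (a - b))
   - (2 ^+ n)^-1 * (((a + b + (a - b)) ^+ n.+1 - (a + b - (a - b)) ^+ n.+1)
       / (2 * n.+1%:R * (a - b)))).
  rewrite -(sum_even_binomial_div (a + b) n ab0) mulr_sumr.
  have ab : a != b by rewrite -subr_eq0.
  rewrite -[X in X - _](sum_bernoulli_add n ab).
  rewrite -sumrB.
  apply: eq_bigr => k _; move: (bernoulli _) => B.
  rewrite !(rmorphM, rmorphB, rmorphXn, fmorphV, rmorph_nat) /= dE sE.
  by rewrite lucasjE; ring.
rewrite aE bE !exprMn (exprS 2).
have : n.+1%:R != 0 :> algC by rewrite pnatr_eq0.
set p := n.+1%:R; clearbody p => p0.
by field; rewrite p0 two0 ab0.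
Qed.
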